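(* Let $\mathcal P$ be a (locally finite) 2-unitary operad over the field $\Bbbk$, with truncation ideals ${}^k\Upsilon$, $k\ge 0$. (1) If $\mathcal P$ has polynomial growth (that is, $\operatorname{GKdim}\mathcal P<\infty$), then the generating series $G_{\mathcal P}(t)=\sum_{n\ge 0}\dim_{\Bbbk}\mathcal P(n)\,t^n$ is a rational function. As a consequence, $\operatorname{GKdim}\mathcal P\in\mathbb N$. (2) $\mathcal P$ has polynomial growth if and only if there is an integer $k$ such that ${}^k\Upsilon=0$. And (in that case) $$\operatorname{GKdim}\mathcal P=\max\{k\mid {}^k\Upsilon\ne 0\}+1=\min\{k\mid {}^k\Upsilon=0\}.$$
   Context: Fix a field $\Bbbk$; all operads are $\Bbbk$-linear. An operad (= symmetric operad) $\mathcal P$ consists of right $\Bbbk\mathbb S_n$-modules $\mathcal P(n)$, $n\ge 0$ (action denoted $*$), an identity $\mathbf 1=\mathbf 1_1\in\mathcal P(1)$, and multilinear compositions $\theta\circ(\theta_1,\dots,\theta_n)\in\mathcal P(k_1+\dots+k_n)$ for $\theta\in\mathcal P(n)$, $\theta_i\in\mathcal P(k_i)$, satisfying the usual unit, associativity and equivariance axioms. $\mathcal P$ is unitary if $\mathcal P(0)=\Bbbk\mathbf 1_0\cong\Bbbk$ with a fixed basis element $\mathbf 1_0$. $\mathcal P$ is 2-unitary if it is unitary and there is $\mathbf 1_2\in\mathcal P(2)$ with $\mathbf 1_2\circ(\mathbf 1_0,\mathbf 1)=\mathbf 1=\mathbf 1_2\circ(\mathbf 1,\mathbf 1_0)$. Truncations: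 let $[n]=\{1,\dots,n\}$. For $I\subseteq[n]$ with characteristic function $\chi_I$, let $\pi^I:\mathcal P(n)\to\mathcal P(|I|)$, $\pi^I(\theta)=\theta\circ(\mathbf 1_{\chi_I(1)},\dots,\mathbf 1_{\chi_I(n)})$. For $k\ge1$, ${}^k\Upsilon(n)=\bigcap_{I\subseteq[n],|I|=k-1}\ker\pi^I$ if $n\ge k$, and ${}^k\Upsilon(n)=0$ if $n<k$; ${}^0\Upsilon=\mathcal P$. Write ${}^k\Upsilon=({}^k\Upsilon(n))_{n\ge0}$. $\mathcal P$ is locally finite if $\dim_\Bbbk\mathcal P(n)<\infty$ for all $n$; this is implicitly assumed whenever GKdimension is discussed. $\operatorname{GKdim}\mathcal P=\limsup_{n\to\infty}\log_n\big(\sum_{i=0}^n\dim_\Bbbk\mathcal P(i)\big)$, and $\mathcal P$ has polynomial growth if $\operatorname{GKdim}\mathcal P<\infty$. *)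

(* Defs.v *)
From HB Require Import structures.
From mathcomp Require Import all_boot all_order all_fingroup all_algebra.
From mathcomp Require Import all_classical all_reals all_analysis.
Set Implicit Arguments.
Unset Strict Implicit.
Unset Printing Implicit Defensive.
Import Order.TTheory GRing.Theory Num.Theory.
Local Open Scope ring_scope.

(* Throughout, 'I_(\sum_i k i) is identified with the set of pairs (i, j),
   i : 'I_n, j : 'I_(k i), in lexicographic order, through the bijections
   tagnat.Rank (with inverse tagnat.sig1, tagnat.sig2) of order.v. *)

Section BlockPermutations.
Local Open Scope nat_scope.
Variables (n : nat) (k : 'I_n -> nat).

Lemma sum_block (s : 'S_n) : \sum_i k i = \sum_i k (s i).
Proof. by rewrite (reindex_inj (@perm_inj _ s)). Qed.

Definition block_fun (s : 'S_n) (p : 'I_(\sum_i k i)) : 'I_(\sum_i k i) :=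
  tagnat.Rank (s (tagnat.sig1 (cast_ord (sum_block s) p)))
              (tagnat.sig2 (cast_ord (sum_block s) p)).

Lemma block_fun_inj (s : 'S_n) : injective (block_fun s).
Proof.
move=> p q; rewrite /block_fun.
move: (cast_ord _ p) (cast_ord _ q) (@cast_ord_inj _ _ (sum_block s) p q).
move=> p' q' pq /tagnat.rank_inj eqpq; apply: pq; apply: tagnat.sig_inj.
rewrite !tagnat.sigE12.
move: (tagnat.sig1 p') (tagnat.sig2 p') (tagnat.sig1 q') (tagnat.sig2 q') eqpq.
move=> i j i' j' eqpq; have ii' : i = i'.
  by apply: (@perm_inj _ s); exact: (congr1 (@tag _ _) eqpq).
by case: _ / ii' j' eqpq => j' /eqP; rewrite eq_Tagged /= => /eqP ->.
Qed.

(* The permutation (i, j) |-> (s i, j), from blocks of sizes k (s i) to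
   blocks of sizes k i. *)
Definition block_perm (s : 'S_n) : 'S_(\sum_i k i) := perm (@block_fun_inj s).

Definition dsum_fun (t : forall i, 'S_(k i)) (p : 'I_(\sum_i k i)) :
    'I_(\sum_i k i) :=
  tagnat.Rank (tagnat.sig1 p) (t (tagnat.sig1 p) (tagnat.sig2 p)).

Lemma dsum_fun_inj (t : forall i, 'S_(k i)) : injective (dsum_fun t).
Proof.
move=> p q /tagnat.rank_inj eqpq; apply: tagnat.sig_inj.
rewrite !tagnat.sigE12.
move: (tagnat.sig1 p) (tagnat.sig2 p) (tagnat.sig1 q) (tagnat.sig2 q) eqpq.
move=> i j i' j' eqpq; have ii' : i = i' by exact: (congr1 (@tag _ _) eqpq).
by case: _ / ii' j' eqpq => j' /eqP; rewrite eq_Tagged /= => /eqP /perm_inj ->.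
Qed.

(* The permutation t_1 (+) ... (+) t_n, i.e. (i, j) |-> (i, t_i j). *)
Definition dsum_perm (t : forall i, 'S_(k i)) : 'S_(\sum_i k i) :=
  perm (@dsum_fun_inj t).

End BlockPermutations.

(* x = y up to the equality m = n of arities, which need not hold by conversion:
   equality in the disjoint union of the V i. *)
Definition eq_arity (K : fieldType) (V : nat -> vectType K) (m n : nat)
    (x : V m) (y : V n) : Prop :=
  existT (fun i => V i : Type) m x = existT (fun i => V i : Type) n y.

Notation "x =~ y" := (eq_arity x y) (at level 70).

(* Locally finite K-linear symmetric operads: each component is a vectType, that
   is, a finite-dimensional K-vector space.
   - MathComp composes permutations from left to right, (s * t) i = t (s i); so
     op_actM is (x * s) * t = x * (s o t), i.e. the action is a right one.
   - In op_equivl, the usual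
       (x * s) o (z_1, ..., z_n) = (x o (z_(s^-1 1), ..., z_(s^-1 n))) * block
     is written with z_i := y_(s i). *)
Record operad (K : fieldType) := Operad {
  op_space :> nat -> vectType K;
  op_act : forall n, op_space n -> 'S_n -> op_space n;
  op_one : op_space 1%N;
  op_comp : forall n (k : 'I_n -> nat), op_space n ->
    (forall i, op_space (k i)) -> op_space (\sum_i k i)%N;
  op_act_linear : forall n (s : 'S_n), linear (fun x => op_act x s);
  op_act1 : forall n (x : op_space n), op_act x 1%g = x;
  op_actM : forall n (x : op_space n) (s t : 'S_n),
    op_act (op_act x s) t = op_act x (t * s)%g;
  op_comp_linearl : forall n (k : 'I_n -> nat) (y : forall i, op_space (k i)),
    linear (fun x => op_comp x y);
  op_comp_linearr : forall n (k : 'I_n -> nat) (x : op_space n)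
      (y : forall i, op_space (k i)) (i : 'I_n),
    linear (fun z : op_space (k i) => op_comp x (eqtype.dfwith y z));
  op_comp1 : forall n (x : op_space n),
    op_comp (k := fun _ : 'I_n => 1%N) x (fun=> op_one) =~ x;
  op_1comp : forall n (x : op_space n),
    op_comp (k := fun _ : 'I_1 => n) op_one (fun=> x) =~ x;
  op_compA : forall n (k : 'I_n -> nat) (l : 'I_(\sum_i k i)%N -> nat)
      (x : op_space n) (y : forall i, op_space (k i))
      (z : forall p, op_space (l p)),
    op_comp (op_comp x y) z =~
    op_comp x (fun i => op_comp (y i) (fun j => z (tagnat.Rank i j)));
  op_equivl : forall n (k : 'I_n -> nat) (x : op_space n)
      (y : forall i, op_space (k i)) (s : 'S_n),
    op_comp (op_act x s) (fun i => y (s i)) =~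
    op_act (op_comp x y) (block_perm k s);
  op_equivr : forall n (k : 'I_n -> nat) (x : op_space n)
      (y : forall i, op_space (k i)) (t : forall i, 'S_(k i)),
    op_comp x (fun i => op_act (y i) (t i)) =
    op_act (op_comp x y) (dsum_perm t)
}.

Section Truncation.
Variables (K : fieldType) (P : operad K) (one0 : P 0%N).

Definition unitary_operad : Prop := one0 != 0 /\ (<[one0]> = fullv)%VS.

Definition one_chi (b : bool) : P b :=
  match b return P (nat_of_bool b) with true => op_one P | false => one0 end.

(* The codomain is P #|I|, since \sum_i (i \in I) = #|I|. *)
Definition trunc n (I : {set 'I_n}) (x : P n) : P (\sum_i (i \in I))%N :=
  op_comp x (fun i => one_chi (i \in I)).

Lemma trunc_linear n (I : {set 'I_n}) : linear (trunc I).
Proof. exact: op_comp_linearl. Qed.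

HB.instance Definition _ n (I : {set 'I_n}) :=
  GRing.isLinear.Build K (P n) (P (\sum_i (i \in I))%N) _ (trunc I)
    (trunc_linear I).

(* With 'I_2 = {0, 1}: the truncation at {1} is x o (1_0, 1), the truncation at
   {0} is x o (1, 1_0). *)
Definition two_unitary_operad : Prop :=
  unitary_operad /\
  exists one2 : P 2%N,
    trunc [set ord_max : 'I_2] one2 =~ op_one P /\
    trunc [set ord0 : 'I_2] one2 =~ op_one P.

Definition upsilon (k n : nat) : {vspace P n} :=
  if k is k'.+1 then
    if (k <= n)%N then
      (\bigcap_(I : {set 'I_n} | #|I| == k') lker (linfun (trunc I)))%VS
    else 0%VS
  else fullv.

Definition upsilon_zero (k : nat) : Prop := forall n, upsilon k n = 0%VS.

End Truncation.

Definition GKdim (R : realType) (K : fieldType) (P : operad K) : \bar R :=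
  limn_esup (fun n : nat =>
    (ln (\sum_(i < n.+1) \dim {:P i})%N%:R / ln n%:R : R)%:E).

Definition polynomial_growth (R : realType) (K : fieldType) (P : operad K) :
  Prop := (GKdim R P < +oo)%E.

(* Formal power series over rat are given by their sequences of coefficients. *)
Definition gen_series (K : fieldType) (P : operad K) : nat -> rat :=
  fun n => (\dim {:P n})%:R.

Definition series_mul (a b : nat -> rat) : nat -> rat :=
  fun n => \sum_(i < n.+1) a i * b (n - i)%N.

Definition rational_series (a : nat -> rat) : Prop :=
  exists p q : {poly rat},
    q != 0 /\ forall n, series_mul (fun i => q`_i) a n = p`_n.

Definition is_max (A : nat -> Prop) (m : nat) : Prop :=
  A m /\ forall k, A k -> (k <= m)%N.

Definition is_min (A : nat -> Prop) (m : nat) : Prop :=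
  A m /\ forall k, A k -> (m <= k)%N.

(* Main.v *)
Require Import Defs.
From mathcomp Require Import all_boot all_order all_fingroup all_algebra.
From mathcomp Require Import all_classical all_reals all_analysis.
From mathcomp Require Import zify.

(** Everything follows from one formula. Let gamma_k be the dimension of the
   space of those x in P(k) which die as soon as any single input is filled
   with 1_0. Then

     dim P(n) = \sum_k 'C(n, k) * gamma_k        ([dim_newton]).

   Filling one input with 1_0 gives maps del_a : P(n+1) -> P(n) satisfying the
   simplicial identity del_a del_b = del_(b-1) del_a for a < b ([del_del]), and
   1_2 provides degeneracies: replacing the input j of x by 1_2 doubles that
   input, and filling either copy with 1_0 gives x back. Hence, as in the
   Dold-Kan normalization, let N(n, j) be the intersection of the kernels of
   del_0, ..., del_(j-1) on P(n): del_j maps N(n+1, j) onto N(n, j) with kernel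
   N(n+1, j+1), so that

     dim N(n+1, j) = dim N(n, j) + dim N(n+1, j+1)   ([dim_normalizedS]),

   and Newton's forward difference formula turns this recurrence into the
   formula above.

   The truncation ideals are read off from the gamma_k: Upsilon^k = 0 if and
   only if gamma_j = 0 for all j >= k ([upsilon_zeroP]). For j >= k, Upsilon^k(j)
   contains N(j, j). Conversely, for n >= k the maps del_a send
   Upsilon^k(n+1) to Upsilon^k(n), and so, by induction on n, an element of Upsilon^k(n) lies in
   N(n, n).

   If gamma_j <> 0, then \sum_(i <= n) dim P(i) >= 'C(n + 1, j + 1), which grows
   like n^(j + 1), so the GK dimension is at least j + 1. If moreover M is the
   largest index with gamma_M <> 0, the same sum is at most a multiple of
   n^(M + 1), so the GK dimension is M + 1; it is infinite when there is no
   largest one. Finally \sum_n \sum_(k < m) 'C(n, k) gamma_k t^n is rational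
   because its difference sequence has the same form with fewer terms
   ([rational_series_antidiff]). *)

Set Implicit Arguments.
Unset Strict Implicit.
Unset Printing Implicit Defensive.
Import Order.TTheory GRing.Theory Num.Theory.
Local Open Scope ring_scope.

(** * Operadic composition on elements of all arities *)

Section Elements.
Variables (K : fieldType) (P : operad K).

(** An element together with its arity. Arities such as \sum_i (i != a) are only
   propositionally equal to the expected ones; in this union the operad axioms
   become plain equalities, by which one can rewrite. *)
Definition elt : Type := {n : nat & (P n : Type)}.
Definition Elt n (x : P n) : elt := existT (fun i => P i : Type) n x.
Definition ar (x : elt) : nat := projT1 x.
Definition one : elt := Elt (op_one P).

(** The inputs are indexed by nat rather than by 'I_n, so that the family f keeps
   its type when the arity of x changes; only f 0, ..., f (ar x - 1) matter. *)
Definition comp (x : elt) (f : nat -> elt) : elt :=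
  Elt (op_comp (k := fun i : 'I_(ar x) => ar (f i)) (projT2 x)
         (fun i => projT2 (f i))).

Lemma Elt_inj n : injective (@Elt n).
Proof. by move=> x y; exact: (@eq_from_Tagged _ (fun i => P i : Type)). Qed.

(** The bridge from [op_comp], whose inputs are indexed by ordinals. *)
Lemma comp_elt n (x : P n) (f : 'I_n -> elt) (g : nat -> elt) :
  (forall i, f i = g i) ->
  Elt (op_comp (k := fun i => ar (f i)) x (fun i => projT2 (f i)))
  = comp (Elt x) g.
Proof. by move=> fg; have -> : f = (fun i => g i) by apply: funext. Qed.

Lemma eq_comp x f g : (forall i, (i < ar x)%N -> f i = g i) ->
  comp x f = comp x g.
Proof.
case: x => n x fg.
by rewrite -[RHS](@comp_elt n x (fun i => f i)) // => i; apply: fg.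
Qed.

Lemma comp1 x : comp x (fun=> one) = x.
Proof. by case: x => n x; exact: op_comp1. Qed.

Lemma one_comp f : comp one f = f 0%N.
Proof.
transitivity (comp one (fun=> f 0%N)); first by apply: eq_comp => -[].
by case: (f 0%N) => n x; exact: op_1comp.
Qed.

Lemma comp_nullary x f : ar x = 0%N -> comp x f = x.
Proof. by move=> x0; rewrite -[RHS]comp1; apply: eq_comp; rewrite x0. Qed.

(** Input j of the i-th block has rank j plus the total arity of the blocks
   before it. *)
Lemma compA x f g : comp (comp x f) g =
  comp x (fun i => comp (f i) (fun j => g (\sum_(l < i) ar (f l) + j)%N)).
Proof.
case: x => n x.
have := op_compA x (fun i => projT2 (f i)) (fun p => projT2 (g p)).
rewrite /eq_arity => E; rewrite [LHS]E.
pose G (i : 'I_n) (j : 'I_(ar (f i))) :=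
  g (@tagnat.Rank n (fun i => ar (f i)) i j).
apply: (@comp_elt n x (fun i => Elt (op_comp (k := fun j => ar (G i j))
  (projT2 (f i)) (fun j => projT2 (G i j))))).
move=> i; rewrite (comp_elt (projT2 (f i))
  (g := (fun j => g (\sum_(l < i) ar (f l) + j)%N))).
  by case: (f i).
move=> j; rewrite /G; congr g; rewrite tagnat.RankEsum; congr addn.
rewrite -(big_mkord xpredT (fun i => ar (f i))) (big_nat_widen _ _ n) ?big_mkord //.
exact: ltnW.
Qed.

Definition is0 (x : elt) : Prop := projT2 x = 0.

Lemma comp0l x f : is0 x -> is0 (comp x f).
Proof.
case: x => n x; rewrite /is0 /= => ->.
have := op_comp_linearl (fun i : 'I_n => projT2 (f i)) (-1) 0 0.
by rewrite scaler0 addr0 scaleN1r addNr.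
Qed.

Lemma comp0r x f i : (i < ar x)%N -> is0 (f i) -> is0 (comp x f).
Proof.
case: x => n x i_n fi0; rewrite /is0 /= in i_n *.
pose y (j : 'I_n) := projT2 (f j).
have := op_comp_linearr x y (i := Ordinal i_n) (-1) 0 0.
rewrite scaler0 addr0 scaleN1r addNr => <-; congr op_comp.
apply: functional_extensionality_dep => j.
have [->|ji] := eqVneq j (Ordinal i_n); first by rewrite eqtype.dfwith_in /y /= fi0.
by rewrite eqtype.dfwith_out // eq_sym.
Qed.

End Elements.

(** * Truncations and single deletions *)

Section Truncations.
Variables (K : fieldType) (P : operad K) (one0 : P 0%N).

Definition chi (b : bool) : elt P := if b then one P else Elt one0.

Lemma ar_chi b : ar (chi b) = b. Proof. by case: b. Qed.

Lemma chiE b : Elt (one_chi one0 b) = chi b. Proof. by case: b. Qed.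

Definition tr (b : pred nat) (x : elt P) : elt P := comp x (fun i => chi (b i)).

Lemma ar_tr b x : ar (tr b x) = (\sum_(i < ar x) b i)%N.
Proof. by rewrite /tr /=; apply: eq_bigr => i _; rewrite ar_chi. Qed.

Lemma tr_chi b x : tr b (chi x) = chi (x && b 0%N).
Proof. by case: x => /=; [exact: one_comp|exact: comp_nullary]. Qed.

Lemma eq_tr b c x : (forall i, (i < ar x)%N -> b i = c i) -> tr b x = tr c x.
Proof. by move=> bc; apply: eq_comp => i /bc ->. Qed.

(** The input i of x, if it is kept by b, becomes the input number
   \sum_(l < i) b l of the truncation, where c decides its fate. *)
Lemma tr_tr b c x :
  tr c (tr b x) = tr (fun i => b i && c (\sum_(l < i) b l)%N) x.
Proof.
rewrite /tr compA; apply: eq_comp => i _.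
under eq_fun do under eq_bigr do rewrite ar_chi.
rewrite -/(tr (fun j => c (\sum_(l < i) b l + j)%N) (chi (b i))).
by rewrite tr_chi addn0.
Qed.

Lemma trunc_tr n (I : {set 'I_n}) (x : P n) (b : pred nat) :
  (forall i : 'I_n, (i \in I) = b i) ->
  Elt (trunc one0 I x) = tr b (Elt x).
Proof.
move=> Ib; rewrite /trunc.
have := @comp_elt _ P n x (fun i => Elt (one_chi one0 (i \in I)))
  (fun i => chi (b i)).
by apply=> i; rewrite chiE Ib.
Qed.

Definition del (a : nat) : elt P -> elt P := tr (fun i => i != a).

Lemma sum_del (a n : nat) : (\sum_(i < n) (i != a :> nat) = n - (a < n))%N.
Proof.
elim: n => [|n IH]; first by rewrite big_ord0.
rewrite big_ord_recr /= IH; case: eqVneq; lia.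
Qed.

Lemma ar_del a x : (ar (del a x) = ar x - (a < ar x))%N.
Proof. by rewrite ar_tr sum_del. Qed.

Lemma tr_del b a x :
  tr b (del a x) = tr (fun i => (i != a) && b (i - (a < i))%N) x.
Proof. by rewrite tr_tr; apply: eq_tr => i _; rewrite sum_del. Qed.

(** The simplicial identity between faces. *)
Lemma del_del a b x : (a < b)%N -> del a (del b x) = del b.-1 (del a x).
Proof.
move=> ab; rewrite /del 2!tr_del; apply: eq_tr => i _ /=; lia.
Qed.

(** * Insertion of an input, from the binary unit *)

Section Insertion.
Variable mul2 : elt P.
Hypotheses (ar_mul2 : ar mul2 = 2%N) (del0_mul2 : del 0 mul2 = one P)
  (del1_mul2 : del 1 mul2 = one P).

(** The degeneracy doubling the input j by means of 1_2. *)
Definition ins (j : nat) (x : elt P) : elt P :=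
  comp x (fun i => if i == j then mul2 else one P).

Lemma sum_ins (j n : nat) :
  (\sum_(i < n) ar (if val i == j then mul2 else one P) = n + (j < n))%N.
Proof.
elim: n => [|n IH]; first by rewrite big_ord0.
rewrite big_ord_recr /= IH; case: eqVneq => [->|nj]; rewrite ?ar_mul2 /=; lia.
Qed.

Lemma ar_ins j x : (j < ar x)%N -> ar (ins j x) = (ar x).+1.
Proof. by move=> jx; rewrite [LHS](sum_ins j (ar x)) jx addn1. Qed.

Lemma del_ins j x : del j (ins j x) = x.
Proof.
rewrite /del /tr compA -[RHS]comp1; apply: eq_comp => i _.
rewrite sum_ins; have [->|ij] := eqVneq i j.
  rewrite -del0_mul2; apply: eq_comp => l _; congr chi; lia.
rewrite one_comp (_ : (_ != _) = true) //; lia.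
Qed.

Lemma del_ins_lt a j x : (a < j)%N -> del a (ins j x) = ins j.-1 (del a x).
Proof.
move=> aj; rewrite /del /tr /ins !compA; apply: eq_comp => i _.
under [in RHS]eq_fun do under eq_bigr do rewrite ar_chi.
rewrite sum_ins sum_del; have [->|ij] := eqVneq i j.
  have -> : (j != a) = true by lia.
  rewrite one_comp (_ : (_ == _) = true); last lia.
  rewrite -[RHS]comp1; apply: eq_comp => l _.
  by have -> : (j + (j < j) + l != a)%N = true by lia.
rewrite one_comp; have [->|ia] := eqVneq i a.
  by rewrite comp_nullary //; congr chi; lia.
rewrite one_comp (_ : (_ != _) = true); last lia.
by rewrite (_ : (_ == _) = false) //; lia.
Qed.

(** 1_2 o (x, 1), the insertion at place ar x, where [ins] finds no input to
   double. *)
Definition append (x : elt P) : elt P :=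
  comp mul2 (fun i => if i == 0%N then x else one P).

Lemma ar_append x : ar (append x) = (ar x).+1.
Proof.
transitivity (\sum_(i < ar mul2) ar (if val i == 0 then x else one P))%N => //.
by rewrite ar_mul2 big_ord_recl big_ord1 /= addn1.
Qed.

Lemma del_append a x : a = ar x -> del a (append x) = x.
Proof.
move=> ->; rewrite -[RHS](one_comp (fun=> x)) -del1_mul2 /del /tr !compA.
apply: eq_comp; rewrite ar_mul2; case=> [|[|//]] _ /=.
  rewrite one_comp -[RHS]comp1; apply: eq_comp => i ix.
  by rewrite big_ord0 (_ : (_ != _) = true) //; lia.
by rewrite one_comp big_ord1 addn0 eqxx comp_nullary.
Qed.

(** del_a is applied inside the first argument of 1_2, and composition is linear
   in that argument. *)
Lemma del_append_lt a x : (a < ar x)%N -> is0 (del a x) -> is0 (del a (append x)).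
Proof.
move=> ax dx; rewrite /del /tr compA; apply: (@comp0r _ _ _ _ 0%N).
  by rewrite ar_mul2.
rewrite [X in is0 X](_ : _ = del a x) //.
by apply: eq_comp => i _; rewrite big_ord0.
Qed.

End Insertion.

Lemma elt_ar n (x : elt P) : ar x = n -> exists y : P n, x = Elt y.
Proof. by case: x => m y /= <-; exists y. Qed.

(** * The normalized subspaces and Newton's formula *)

Definition normalized (n j : nat) : {vspace P n} :=
  (\bigcap_(a < j) lker (linfun (trunc one0 [set i : 'I_n | i != a :> nat])))%VS.

Lemma trunc_del n a (x : P n) :
  Elt (trunc one0 [set i : 'I_n | i != a :> nat] x) = del a (Elt x).
Proof. by apply: trunc_tr => i; rewrite inE. Qed.

Lemma memv_bigcap (I : finType) (Q : pred I) n (F : I -> {vspace P n}) x :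
  reflect (forall i, Q i -> x \in F i) (x \in \bigcap_(i | Q i) F i)%VS.
Proof. exact: subv_bigcapP. Qed.

Lemma normalizedP n j (x : P n) :
  (x \in normalized n j) <-> (forall a, (a < j)%N -> is0 (del a (Elt x))).
Proof.
split=> [/memv_bigcap xn a aj|x0].
  have := xn (Ordinal aj) isT; rewrite memv_ker lfunE /= => /eqP.
  by rewrite -trunc_del.
apply/memv_bigcap => a _; rewrite memv_ker lfunE /=; apply/eqP.
by rewrite -[_ = 0]/(is0 (Elt _)) trunc_del; exact: x0.
Qed.

Hypothesis two_unit : two_unitary_operad one0.

Lemma two_unit_mul : exists mul2 : elt P,
  [/\ ar mul2 = 2%N, del 0 mul2 = one P & del 1 mul2 = one P].
Proof.
case: two_unit => _ [one2 [d0 d1]]; exists (Elt one2); split => //.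
- rewrite -[RHS]d0 -[LHS]trunc_del; congr (Elt (trunc _ _ _)).
  by apply/setP => -[[|[|//]] ?]; rewrite !inE.
- rewrite -[RHS]d1 -[LHS]trunc_del; congr (Elt (trunc _ _ _)).
  by apply/setP => -[[|[|//]] ?]; rewrite !inE.
Qed.

(** Rank-nullity for the restriction of del_j to N(n + 1, j), whose kernel is
   N(n + 1, j + 1) by definition. Its image lies in N(n, j) by [del_del], and is
   all of it because inserting an input at place j is a section of del_j
   compatible with the earlier deletions. *)
Lemma dim_normalizedS n j : (j <= n)%N ->
  (\dim (normalized n.+1 j)
   = \dim (normalized n j) + \dim (normalized n.+1 j.+1))%N.
Proof.
move=> jn; have [mul2 [ar_mul2 d0 d1]] := two_unit_mul.
set f := linfun (trunc one0 [set i : 'I_n.+1 | i != j :> nat]).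
have -> : normalized n.+1 j.+1 = (normalized n.+1 j :&: lker f)%VS.
  by rewrite /normalized big_ord_recr.
rewrite -(limg_ker_dim f (normalized n.+1 j)) addnC; congr addn.
have ar_f : (\sum_i (i \in [set i : 'I_n.+1 | i != j :> nat]) = n)%N.
  by under eq_bigr do rewrite inE; rewrite sum_del; lia.
(* The codomain of f has an arity only provably equal to n; comparing subspaces
   there and rewriting the arity afterwards avoids transporting vectors. *)
suff -> : (f @: normalized n.+1 j = normalized _ j)%VS by rewrite ar_f.
apply/vspaceP => y; apply/memv_imgP/idP => [[x xn ->]|/normalizedP yn].
  apply/normalizedP => a aj; rewrite lfunE /= trunc_del del_del //.
  by apply: comp0l; move/normalizedP: xn; exact.
(* Doubling the input j needs j < n; otherwise the new input comes last. *)
pose X := if j == n then append mul2 (Elt y) else ins mul2 j (Elt y).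
have arX : ar X = n.+1.
  rewrite /X; case: eqP => [_|nj]; first by rewrite ar_append //= ar_f.
  by rewrite ar_ins //= ar_f //; lia.
have [x xE] := elt_ar arX; exists x.
  apply/normalizedP => a aj; rewrite -xE /X; case: eqP => [E|_].
    by apply: del_append_lt => //=; [rewrite ar_f; lia|exact: yn].
  by rewrite del_ins_lt //; apply: comp0l; exact: yn.
apply: Elt_inj.
rewrite lfunE /= trunc_del -xE /X; case: eqP => [jE|_]; last by rewrite del_ins.
by rewrite del_append //= ar_f.
Qed.

Definition gamma (k : nat) : nat := \dim (normalized k k).

(** Read as a sequence in n, dim N(n + j, j) has difference sequence
   dim N(n + j + 1, j + 1) and initial value gamma j: this is Newton's forward
   difference formula. *)
Lemma dim_normalized_newton n j :
  (\dim (normalized (n + j) j) = \sum_(k < n.+1) 'C(n, k) * gamma (j + k))%N.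
Proof.
elim: n j => [|n IH] j; first by rewrite big_ord1 bin0 mul1n addn0 add0n.
rewrite addSn dim_normalizedS ?leq_addl // -addnS !IH.
rewrite [RHS]big_ord_recl [in LHS]big_ord_recl /= !bin0 -addnA; congr addn.
under [in RHS]eq_bigr do rewrite /= binS mulnDl.
rewrite big_split /= [in RHS]big_ord_recr /= bin_small // mul0n addn0; congr addn.
by apply: eq_bigr => k _; rewrite addSnnS.
Qed.

Lemma dim_newton n : (\dim {:P n} = \sum_(k < n.+1) 'C(n, k) * gamma k)%N.
Proof.
have := dim_normalized_newton n 0; rewrite addn0 => <-.
by rewrite /normalized big_ord0.
Qed.

(** * The truncation ideals in terms of gamma *)

Lemma upsilonP k n (x : P n) : (k <= n)%N ->
  (x \in upsilon one0 k n) <->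
  (forall b : pred nat, (\sum_(i < n) b i).+1 = k -> is0 (tr b (Elt x))).
Proof.
case: k => [|k] kn /=; first by rewrite memvf; split=> // _ b.
have cardE (I : {set 'I_n}) : #|I| = (\sum_i (i \in I))%N.
  by rewrite -sum1_card big_mkcond; apply: eq_bigr => i _; case: (i \in I).
rewrite kn; split=> [/memv_bigcap xU b [bk]|x0].
  have bE (i : 'I_n) : (i \in [set i : 'I_n | b i]) = b i by rewrite inE.
  rewrite -(trunc_tr x bE).
  have := xU [set i : 'I_n | b i]; rewrite memv_ker lfunE /= => U.
  apply/eqP/U/eqP; rewrite cardE -bk.
  by apply: eq_bigr => i _; rewrite inE.
apply/memv_bigcap => I /eqP Ik; rewrite memv_ker lfunE /=; apply/eqP.
pose b j := [exists i in I, val i == j].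
have bE (i : 'I_n) : (i \in I) = b i.
  apply/idP/existsP => [iI|[j /andP[jI /eqP/val_inj <- //]]].
  by exists i; rewrite iI eqxx.
rewrite -[_ = 0]/(is0 (Elt _)) (trunc_tr x bE); apply: x0.
by rewrite -Ik cardE; congr S; apply: eq_bigr => i _; rewrite bE.
Qed.

(** A truncation to fewer inputs than there are factors through some del_a. *)
Lemma normalized_sub_upsilon k n : (k <= n)%N ->
  (normalized n n <= upsilon one0 k n)%VS.
Proof.
move=> kn; apply/subvP => x /normalizedP x0; apply/(upsilonP x kn) => b bk.
have [a ba] : exists a : 'I_n, ~~ b a.
  apply/existsP; apply: contraLR kn => /existsPn bT.
  rewrite -ltnNge -bk ltnS -[n in (n <= _)%N]card_ord -sum1_card.
  by apply: leq_sum => i _; move/negPn: (bT i) => ->.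
have -> : tr b (Elt x) = tr (fun i => b (i + (a <= i))%N) (del a (Elt x)).
  rewrite tr_del; apply: eq_tr => i _.
  have [->|ia] := eqVneq i (a : nat); first exact/negbTE.
  by congr b; lia.
by apply: comp0l; apply: x0.
Qed.

(** By induction on the arity: for x in Upsilon^k(n) with k < n each del_a x lies
   in Upsilon^k(n - 1), hence vanishes; for k = n the maps del_a are the very
   truncations defining Upsilon^n(n). Either way x lies in N(n, n). *)
Lemma upsilon_eq0 k : (forall j, (k <= j)%N -> gamma j = 0%N) ->
  upsilon_zero one0 k.
Proof.
move=> g0 n; have [kn|] := leqP k n; last first.
  by case: k g0 => // k _ nk; rewrite /upsilon leqNgt nk.
apply/eqP; rewrite -subv0; apply/subvP => x /(upsilonP x kn) xU.
rewrite memv0; apply/eqP.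
suff H m (X : elt P) : (k <= ar X)%N -> ar X = m ->
    (forall b : pred nat, (\sum_(i < ar X) b i).+1 = k -> is0 (tr b X)) -> is0 X.
  exact: (H n (Elt x)).
elim: m X => [|m IH] [n' X] /= kX arX XU.
all: have: X \in normalized n' n'; last first.
all: try by move/eqP: (g0 _ kX); rewrite dimv_eq0 => /eqP ->; rewrite memv0 => /eqP.
  by apply/normalizedP => a an; exfalso; lia.
apply/normalizedP => a an.
have [E|kn'] := eqVneq k n'.
  by apply: XU; rewrite sum_del an; lia.
have arD : ar (del a (Elt X)) = m by rewrite ar_del /= an; lia.
apply: IH; rewrite ?arD //; first by lia.
move=> b bk; rewrite tr_del; apply: XU.
rewrite -bk; congr S; rewrite -arD.
by rewrite -[RHS](ar_tr b) tr_del ar_tr.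
Qed.

Lemma upsilon_zeroP k :
  upsilon_zero one0 k <-> (forall j, (k <= j)%N -> gamma j = 0%N).
Proof.
split=> [U0 j kj|]; last exact: upsilon_eq0.
by apply/eqP; rewrite dimv_eq0 -subv0 -(U0 j) normalized_sub_upsilon.
Qed.

Lemma gamma0 : gamma 0 = 1%N.
Proof.
have [one0_neq0 one0_span] := two_unit.1.
by rewrite /gamma /normalized big_ord0 -one0_span dim_vline one0_neq0.
Qed.

End Truncations.

(** * Rationality of the series *)

(** Truncating the series to a polynomial makes associativity of the Cauchy
   product available from the ring of polynomials. *)
Lemma series_mul_coefM (q : {poly rat}) a n :
  series_mul (fun i => q`_i) a n = (q * \poly_(i < n.+1) a i)`_n.
Proof.
rewrite coefM; apply: eq_bigr => j _.
by rewrite coef_poly ltnS leq_subr.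
Qed.

(** If a and c have generating series A and C, then (1 - t) A = a_0 + t C. *)
Lemma rational_series_antidiff a c :
  rational_series c -> (forall n, a n.+1 = a n + c n) -> rational_series a.
Proof.
move=> [p [q [q0 qc]]] ac; exists (a 0%N *: q + 'X * p), (q * (1 - 'X)).
split.
  rewrite mulf_neq0 // -size_poly_gt0.
  by rewrite -opprB size_polyN size_XsubC.
move=> n; rewrite series_mul_coefM -mulrA coefD coefZ coefXM -qc.
set A := \poly_(i < n.+1) a i.
have dA i : (i <= n)%N ->
    ((1 - 'X) * A)`_i = if i is j.+1 then c j else a 0%N.
  move=> i_n; rewrite mulrBl mul1r coefB coefXM !coef_poly ltnS i_n.
  by case: i i_n => [|i] /= i_n; rewrite ?subr0 // ltnS (ltnW i_n) ac addrC addKr.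
rewrite coefM; case: n => [|n] /= in A dA *.
  by rewrite big_ord1 dA // addr0 mulrC.
rewrite big_ord_recr /= subnn dA // [a 0%N * _]mulrC addrC; congr (_ + _).
by apply: eq_bigr => -[j jn] _ /=; rewrite subSn // dA // ltnS leq_subr.
Qed.

Lemma rational_series_newton m (g : nat -> nat) :
  rational_series (fun n => (\sum_(k < m) 'C(n, k) * g k)%N%:R).
Proof.
elim: m g => [|m IH] g.
  exists 0, 1; split=> [|n]; first exact: oner_neq0.
  rewrite coef0 [LHS]big1 // => i _; by rewrite big_ord0 mulr0.
apply: rational_series_antidiff (IH (fun k => g k.+1)) _ => n.
rewrite -natrD; congr (_%:R); rewrite !big_ord_recl /= !bin0 -addnA; congr addn.
by rewrite -big_split /=; apply: eq_bigr => k _; rewrite binS mulnDl.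
Qed.

(** * Polynomial bounds for the partial sums *)

Section Growth.
Local Open Scope nat_scope.
Variable g : nat -> nat.
Let a n := \sum_(k < n.+1) 'C(n, k) * g k.
Let S n := \sum_(i < n.+1) a i.

Lemma newton_trunc m n : (forall k, m <= k -> g k = 0) ->
  a n = \sum_(k < m) 'C(n, k) * g k.
Proof.
move=> g0; rewrite /a.
rewrite -!(big_mkord xpredT (fun k => 'C(n, k) * g k)).
rewrite (big_nat_widen _ _ (n.+1 + m)) ?leq_addr //.
rewrite [RHS](big_nat_widen _ _ (n.+1 + m)) ?leq_addl //.
rewrite big_mkcond [RHS]big_mkcond; apply: eq_bigr => k _ /=.
case: ltnP => kn; case: ltnP => km //; first by rewrite g0 ?muln0.
by rewrite bin_small.
Qed.

Lemma sum_bin j n : \sum_(i < n.+1) 'C(i, j) = 'C(n.+1, j.+1).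
Proof.
elim: n => [|n IH]; first by rewrite big_ord1 binS [X in X + _]bin0n.
by rewrite big_ord_recr /= IH [RHS]binS.
Qed.

Lemma leq_exp_ffact n m : n ^ m <= (n + m) ^_ m.
Proof.
elim: m => [|m IH] //; rewrite addnS ffactnS expnS leq_mul //; lia.
Qed.

Lemma leq_bin_exp n m : 'C(n, m) <= n ^ m.
Proof.
have [nm|mn] := ltnP n m; first by rewrite bin_small.
rewrite (leq_trans (leq_pmulr _ (fact_gt0 m))) // bin_ffact.
elim: m n mn => // m IH [|n] // mn; rewrite ffactnS expnS leq_mul //=.
rewrite (leq_trans (IH _ _)) //; by case: m {IH mn} => // m; rewrite leq_exp2r.
Qed.

(** The single term 'C(i, j) * g j of each a i already gives
   S n >= 'C(n + 1, j + 1) >= (n - j)^(j + 1) / (j + 1)!, and n - j >= n / 2. *)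
Lemma growth_ge j : 0 < g j ->
  exists2 c, 0 < c & forall n, 2 * j <= n -> n ^ j.+1 <= c * S n.
Proof.
move=> gj; exists (2 ^ j.+1 * j.+1`!).
  by rewrite muln_gt0 expn_gt0 fact_gt0.
move=> n jn.
have Sn : 'C(n.+1, j.+1) <= S n.
  rewrite -sum_bin; apply: leq_sum => i _.
  have [ij|ji] := ltnP i j; first by rewrite bin_small.
  rewrite /a (bigD1 (Ordinal (ji : j < i.+1))) //=.
  by rewrite (leq_trans (leq_pmulr _ gj)) ?leq_addr.
rewrite (leq_trans _ (leq_mul (leqnn _) Sn)) // -mulnA [_`! * _]mulnC bin_ffact.
have := leq_exp_ffact (n - j) j.+1; rewrite (_ : n - j + j.+1 = n.+1); last lia.
move=> /(leq_mul (leqnn (2 ^ j.+1))); apply: leq_trans.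
by rewrite -expnMn leq_exp2r //; lia.
Qed.

(** Each of the n + 1 terms a i is at most (n + 1)^m \sum_k g k, and
   n + 1 <= 2 n. *)
Lemma growth_le m : (forall k, m < k -> g k = 0) -> exists c,
  forall n, 0 < n -> S n <= c * n ^ m.+1.
Proof.
move=> g0; exists (2 ^ m.+1 * \sum_(k < m.+1) g k) => n n0.
rewrite /S; under eq_bigr do rewrite (@newton_trunc m.+1) //.
apply: (@leq_trans (\sum_(i < n.+1) n.+1 ^ m * \sum_(k < m.+1) g k)).
  apply: leq_sum => i _; rewrite big_distrr /=; apply: leq_sum => k _.
  rewrite leq_mul // (leq_trans (leq_bin_exp _ _)) //.
  apply: (@leq_trans (n.+1 ^ k)); last by rewrite leq_pexp2l // -ltnS.
  by case: (nat_of_ord k) => // k'; rewrite leq_exp2r // ltnW.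
rewrite sum_nat_const card_ord mulnA -expnS mulnAC leq_mul // -expnMn.
by rewrite leq_exp2r //; lia.
Qed.

End Growth.

(** * Growth exponents as upper limits *)

Section GrowthExponent.
Local Open Scope classical_set_scope.
Variable R : realType.

Lemma le_limn_esup (u v : nat -> \bar R) :
  (\forall n \near \oo, (u n <= v n)%E) -> (limn_esup u <= limn_esup v)%E.
Proof.
move=> uv; apply: le_ereal_inf_tmp => _ [V VF <-].
apply: (@le_trans _ _ (ereal_sup (u @` (V `&` [set n | (u n <= v n)%E])))).
  apply: ereal_inf_lbound; exists (V `&` [set n | (u n <= v n)%E]) => //.
  exact: filterI.
apply: ge_ereal_sup => _ [n [Vn uvn] <-]; apply: (le_trans uvn).
by apply: le_ereal_sup_tmp; exists (v n) => //; exists n.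
Qed.

Lemma cvg_ln_nat : (ln n%:R : R) @[n --> \oo] --> +oo.
Proof.
apply/cvgryPge => A; have /cvgryPge/(_ (expR A)) := @cvgr_idn R.
apply: filterS => n nA; rewrite -[A]expRK ler_ln ?posrE ?expR_gt0 //.
exact: lt_le_trans (expR_gt0 A) nA.
Qed.

(** The sequences against which ln (S n) / ln n is compared. *)
Lemma limn_esup_div_ln (m c : R) :
  limn_esup (fun n => (m + c / ln n%:R)%:E) = m%:E.
Proof.
apply: (cvg_limn_einf_sup _).2; apply: cvg_EFin; first exact: nearW.
rewrite -[X in _ --> X]addr0; apply: cvgD; first exact: cvg_cst.
rewrite -[X in _ --> X](mulr0 c); apply: cvgMr.
apply/gtr0_cvgV0; last exact: cvg_ln_nat.
by have /cvgryPgt := cvg_ln_nat; exact.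
Qed.

Variable S : nat -> nat.
Hypothesis S0 : forall n, (0 < S n)%N.
Let G : \bar R := limn_esup (fun n => (ln (S n)%:R / ln n%:R : R)%:E).

Lemma limn_esup_ln_ge m c N : (0 < c)%N ->
  (forall n, (N <= n)%N -> (n ^ m <= c * S n)%N) -> (m%:R%:E <= G)%E.
Proof.
move=> c0 mS; rewrite -(limn_esup_div_ln m%:R (- ln c%:R)); apply: le_limn_esup.
near=> n; have n1 : (1 < n)%N by near: n; exists 2%N.
have lnn : 0 < ln n%:R :> R by rewrite ln_gt0 // ltr1n.
rewrite lee_fin ler_pdivlMr // mulrDl mulfVK ?gt_eqF // lerBlDl.
rewrite mulr_natl -lnXn ?ltr0n ?(ltnW n1) // -lnM ?posrE ?ltr0n //.
rewrite -natrX -natrM ler_ln ?posrE ?ltr0n ?muln_gt0 ?expn_gt0 ?(ltnW n1) ?c0 ?S0 //.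
by rewrite ler_nat; apply: mS; near: n; exists N.
Unshelve. all: end_near. Qed.

Lemma limn_esup_ln_le m c :
  (forall n, (0 < n)%N -> (S n <= c * n ^ m)%N) -> (G <= m%:R%:E)%E.
Proof.
move=> Sm; rewrite -(limn_esup_div_ln m%:R (ln c%:R)); apply: le_limn_esup.
near=> n; have n1 : (1 < n)%N by near: n; exists 2%N.
have lnn : 0 < ln n%:R :> R by rewrite ln_gt0 // ltr1n.
have c0 : (0 < c)%N.
  by case: c Sm => // /(_ 1%N isT); rewrite mul0n leqNgt S0.
rewrite lee_fin ler_pdivrMr // mulrDl mulfVK ?gt_eqF //.
rewrite addrC mulr_natl -lnXn ?ltr0n ?(ltnW n1) //.
rewrite -lnM ?posrE ?exprn_gt0 ?ltr0n ?(ltnW n1) //.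
rewrite -natrX -natrM ler_ln ?posrE ?ltr0n ?muln_gt0 ?expn_gt0 ?(ltnW n1) ?c0 ?S0 //.
by rewrite ler_nat; apply: Sm; exact: ltnW.
Unshelve. all: end_near. Qed.

End GrowthExponent.

(** * The GK dimension of a 2-unitary operad *)

Section GKdimension.
Variables (R : realType) (K : fieldType) (P : operad K) (one0 : P 0%N).
Hypothesis two_unit : two_unitary_operad one0.

Lemma GKdim_newton : GKdim R P = limn_esup (fun n =>
  (ln (\sum_(i < n.+1) \sum_(k < i.+1) 'C(i, k) * gamma one0 k)%N%:R / ln n%:R
    : R)%:E).
Proof.
by rewrite /GKdim; congr limn_esup; apply: funext => n;
  under eq_bigr do rewrite (dim_newton two_unit).
Qed.

Lemma sum_newton_gt0 n :
  (0 < \sum_(i < n.+1) \sum_(k < i.+1) 'C(i, k) * gamma one0 k)%N.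
Proof. by rewrite big_ord_recl big_ord1 (gamma0 two_unit). Qed.

Lemma GKdim_ge j : (0 < gamma one0 j)%N -> (j.+1%:R%:E <= GKdim R P)%E.
Proof.
rewrite GKdim_newton => /growth_ge[c c0 gc].
exact: (limn_esup_ln_ge R sum_newton_gt0 c0 gc).
Qed.

Lemma GKdim_eq M : (0 < gamma one0 M)%N ->
  (forall k, (M < k)%N -> gamma one0 k = 0%N) -> GKdim R P = M.+1%:R%:E.
Proof.
move=> gM g0; apply/eqP; rewrite eq_le GKdim_ge // andbT GKdim_newton.
have [c gc] := growth_le g0; exact: (limn_esup_ln_le R sum_newton_gt0 gc).
Qed.

(** Were gamma not eventually zero, the lower bounds [GKdim_ge] would be
   unbounded. *)
Lemma polynomial_growth_upsilon :
  polynomial_growth R P -> exists k, upsilon_zero one0 k.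
Proof.
rewrite /polynomial_growth => Gfin; apply: contrapT => /forallNP U.
have Gge k : (k%:R%:E <= GKdim R P)%E.
  have [j kj gj] : exists2 j, (k <= j)%N & (0 < gamma one0 j)%N.
    apply: contrapT => ex; apply: (U k); apply/(upsilon_zeroP one0 _) => j kj.
    by apply/eqP; rewrite -leqn0 leqNgt; apply/negP => gj; apply: ex; exists j.
  by apply: le_trans (GKdim_ge gj); rewrite lee_fin ler_nat ltnW.
case: (GKdim R P) Gfin Gge => [r _ Gge| |_ /(_ 0%N)] //.
have := Gge (Num.truncn r).+1; rewrite lee_fin leNgt; move/negP; apply.
by apply: truncnS_gt.
Qed.

(** Since gamma 0 = 1, the largest index of a nonzero gamma exists. *)
Lemma upsilon_last_gamma : (exists k, upsilon_zero one0 k) ->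
  exists M, (0 < gamma one0 M)%N /\ forall k, (M < k)%N -> gamma one0 k = 0%N.
Proof.
move=> [k /(upsilon_zeroP one0 _) g0].
have ex : exists j, (0 < gamma one0 j)%N by exists 0%N; rewrite (gamma0 two_unit).
have ub j : (0 < gamma one0 j)%N -> (j <= k)%N.
  by rewrite lt0n; apply: contraNleq => /ltnW/g0 ->.
have [M gM maxM] := ex_maxnP ex ub; exists M; split=> // j.
by rewrite ltnNge; apply: contraNeq; rewrite -lt0n; exact: maxM.
Qed.

Lemma upsilon_zero_ltn M : (0 < gamma one0 M)%N ->
  (forall k, (M < k)%N -> gamma one0 k = 0%N) ->
  forall k, upsilon_zero one0 k <-> (M < k)%N.
Proof.
move=> gM g0 k; split=> [/(upsilon_zeroP one0 _) gk|Mk].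
  by rewrite ltnNge; apply/negP => /gk gM0; rewrite gM0 in gM.
by apply/(upsilon_zeroP one0 _) => j kj; apply: g0; exact: leq_trans kj.
Qed.

End GKdimension.

Theorem theorem0p1 (R : realType) (K : fieldType) (P : operad K) (one0 : P 0%N)
    (hP : two_unitary_operad one0) :
  (polynomial_growth R P ->
     rational_series (gen_series P) /\
     exists d : nat, GKdim R P = d%:R%:E) /\
  (polynomial_growth R P <-> exists k : nat, upsilon_zero one0 k) /\
  (polynomial_growth R P ->
     exists M m : nat,
       is_max (fun k => ~ upsilon_zero one0 k) M /\
       is_min (fun k => upsilon_zero one0 k) m /\
       GKdim R P = (M + 1)%:R%:E /\
       GKdim R P = m%:R%:E).
Proof.
have last_gamma := upsilon_last_gamma hP.
have growth_upsilon := @polynomial_growth_upsilon R K P one0 hP.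
split; [|split; [split=> [|/last_gamma[M [gM g0]]]|]] => //.
- move=> /growth_upsilon/last_gamma[M [gM g0]].
  split; last by exists M.+1; exact: GKdim_eq gM g0.
  have -> : gen_series P =
      (fun n => (\sum_(k < M.+1) 'C(n, k) * gamma one0 k)%N%:R).
    apply: funext => n; rewrite /gen_series (dim_newton hP).
    by rewrite (newton_trunc n g0).
  exact: rational_series_newton.
- by rewrite /polynomial_growth (GKdim_eq R hP gM g0) ltry.
- move=> /growth_upsilon/last_gamma[M [gM g0]].
  have U := upsilon_zero_ltn gM g0; have G := GKdim_eq R hP gM g0.
  exists M, M.+1; rewrite addn1; split; [split|split; [split|split]] => //.
  + by move=> /U; rewrite ltnn.
  + by move=> k kU; rewrite leqNgt; apply/negP => /U.
  + exact/U.
  + by move=> k /U.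
Qed.
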